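(* Let $k\ge 2$. Identify $\mathbb{R}^{E(\mathcal{O}_k)}$ with $\mathbb{R}^{\mathcal{S}_k}$ via edge labels. Then $P_k=P(\mathcal{O}_k)$. Consequently, the set of vertices of $P_k$ is $\{\vec{e}_{\mathcal{C}}\mid\mathcal{C}\text{ is a simple cycle of }\mathcal{O}_k\}$, the dimension of $P_k$ is $k!-(k-1)!$, and $$P_k=\Big\{\vec v\in[0,1]^{\mathcal{S}_k}\ \Big|\ \sum_{\pi\in\mathcal{S}_k}v_\pi=1,\ \ \sum_{\pi:\,\mathrm{be}(\pi)=\rho}v_\pi=\sum_{\pi:\,\mathrm{en}(\pi)=\rho}v_\pi\ \text{ for all }\rho\in\mathcal{S}_{k-1}\Big\}.$$
   Context: $\mathcal{S}_n$ is the set of permutations of $[n]$, $\mathcal{S}$ the set of all finite permutations. For distinct reals, $\mathrm{std}(x_1,\dots,x_n)$ is the unique $\pi\in\mathcal{S}_n$ with $\pi(i)<\pi(j)\iff x_i<x_j$; for $\sigma\in\mathcal{S}_n$, $I\subseteq[n]$, $\mathrm{pat}_I(\sigma)=\mathrm{std}((\sigma(i))_{i\in I})$. $\mathrm{c\text{-}occ}(\pi,\sigma)$ is the number of intervals $I\subseteq[n]$ with $\mathrm{pat}_I(\sigma)=\pi$, and $\widetilde{\mathrm{c\text{-}occ}}(\pi,\sigma)=\mathrm{c\text{-}occ}(\pi,\sigma)/n$ for $\sigma\in\mathcal{S}_n$. The feasible region is $P_k=\{\vec v\in[0,1]^{\mathcal{S}_k}\mid\exists(\sigma^m)\in\mathcal{S}^{\mathbb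 N}: |\sigma^m|\to\infty,\ \widetilde{\mathrm{c\text{-}occ}}(\pi,\sigma^m)\to v_\pi\ \forall\pi\in\mathcal{S}_k\}$. For $\pi\in\mathcal{S}_k$, $\mathrm{be}(\pi)=\mathrm{pat}_{[1,k-1]}(\pi)$, $\mathrm{en}(\pi)=\mathrm{pat}_{[2,k]}(\pi)$. The overlap graph $\mathcal{O}_k$ is the directed multigraph with vertex set $\mathcal{S}_{k-1}$ and, for each $\pi\in\mathcal{S}_k$, one edge labeled $\pi$ from $\mathrm{be}(\pi)$ to $\mathrm{en}(\pi)$. For a directed multigraph $G$: a walk is a sequence of edges $(e_1,\dots,e_s)$ with $\mathrm{ar}(e_i)=\mathrm{st}(e_{i+1})$; a cycle is a walk with $\mathrm{st}(e_1)=\mathrm{ar}(e_s)$; a path is a walk with distinct edges and distinct vertices except possibly $\mathrm{st}(e_1)=\mathrm{ar}(e_s)$; a simple cycle is a non-empty cycle that is a path. For a non-empty cycle $\mathcal{C}$, $(\vec{e}_{\mathcal{C}})_e=n_e(\mathcal{C})/|\mathcal{C}|$ ($n_e$ = number of traversals of $e$, $|\mathcal{C}|$ = number of edges), and the cycle polytope is $P(G)=\mathrm{conv}\{\vec{e}_{\mathcal{C}}\mid\mathcal{C}\text{ simple cycle of }G\}$. The dimension of a polytope is that of its affine span. *)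

(* Defs.v *)
From Stdlib Require Import Reals.
From mathcomp Require Import all_boot all_fingroup.
Set Implicit Arguments.
Unset Strict Implicit.
Unset Printing Implicit Defensive.

(* Values of a permutation sigma : 'S_n viewed as a function nat -> nat
   (0-based positions; positions >= n are mapped to 0 and never used). *)
Definition pval (n : nat) (s : 'S_n) (j : nat) : nat :=
  oapp (fun o : 'I_n => val (s o)) 0%N (insub j).

(* std: for f : 'I_k -> nat, the permutation i |-> #{j | f j < f i}
   (0-based rank).  When f is injective this is the unique pi in S_k with
   pi i < pi j <-> f i < f j; otherwise (never used) it defaults to 1. *)
Definition std_fun (k : nat) (f : 'I_k -> nat) : 'I_k -> 'I_k :=
  fun i => insubd i #|[pred j | f j < f i]|.

Definition std (k : nat) (f : 'I_k -> nat) : 'S_k :=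
  match injectiveb (std_fun f) as b return injectiveb (std_fun f) = b -> 'S_k with
  | true => fun H => perm (elimT (injectiveP (std_fun f)) H)
  | false => fun _ => 1%g
  end erefl.

(* pat_{[i+1, i+k]}(sigma) (0-based start position i). *)
Definition pat_at (k n : nat) (s : 'S_n) (i : nat) : 'S_k :=
  std (fun a : 'I_k => pval s (i + a)).

(* c-occ(pi, sigma): number of intervals I of [n] with pat_I(sigma) = pi.
   Only intervals of length k can have pattern pi in S_k. *)
Definition c_occ (k n : nat) (p : 'S_k) (s : 'S_n) : nat :=
  #|[pred i : 'I_n.+1 | (i + k <= n) && (pat_at k s i == p)]|.

Definition c_occ_prop (k n : nat) (p : 'S_k) (s : 'S_n) : R :=
  Rdiv (INR (c_occ p s)) (INR n).

Definition vec (k : nat) := 'S_k -> R.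

Definition feasible_region (k : nat) (v : vec k) : Prop :=
  (forall p : 'S_k, Rle R0 (v p) /\ Rle (v p) R1) /\
  exists s : nat -> {n : nat & 'S_n},
    (forall M : nat, exists N : nat, forall m : nat, (N <= m)%N -> (M <= projT1 (s m))%N) /\
    (forall p : 'S_k, Un_cv (fun m => c_occ_prop p (projT2 (s m))) (v p)).

Definition be (k : nat) (p : 'S_k) : 'S_k.-1 := std (fun a : 'I_k.-1 => pval p a).
Definition en (k : nat) (p : 'S_k) : 'S_k.-1 := std (fun a : 'I_k.-1 => pval p a.+1).

(* Overlap graph O_k: vertex set S_{k-1}; exactly one edge per pi in S_k,
   labeled pi, from be(pi) to en(pi).  Edges are thus identified with their
   labels, and a sequence of edges is a seq 'S_k. *)
Definition ov_st (k : nat) (e : 'S_k) : 'S_k.-1 := be e.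
Definition ov_ar (k : nat) (e : 'S_k) : 'S_k.-1 := en e.

Definition is_walk (k : nat) (w : seq 'S_k) : bool :=
  sorted (fun e f => ov_ar e == ov_st f) w.

Definition is_cycle (k : nat) (w : seq 'S_k) : bool :=
  is_walk w &&
  (if w is e :: w' then ov_st e == ov_ar (last e w') else true).

Definition walk_vertices (k : nat) (w : seq 'S_k) : seq 'S_k.-1 :=
  if w is e :: _ then ov_st e :: map (@ov_ar k) w else [::].

(* path: distinct edges and distinct vertices, except possibly
   st(e_1) = ar(e_s), i.e. all pairs of positions in the vertex sequence
   (of length s+1) are distinct except possibly the pair (0, s). *)
Definition is_path (k : nat) (w : seq 'S_k) : bool :=
  is_walk w && uniq w &&
  uniq (take (size w) (walk_vertices w)) &&
  uniq (drop 1 (walk_vertices w)).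

Definition is_simple_cycle (k : nat) (w : seq 'S_k) : bool :=
  (w != [::]) && is_cycle w && is_path w.

Definition cycle_vec (k : nat) (w : seq 'S_k) : vec k :=
  fun p => Rdiv (INR (count_mem p w)) (INR (size w)).

Definition Rsum (I : Type) (r : seq I) (F : I -> R) : R := foldr (fun i acc => Rplus (F i) acc) R0 r.

Definition conv_hull (k : nat) (S : vec k -> Prop) (v : vec k) : Prop :=
  exists l : seq (R * vec k),
    (forall c, List.In c l -> Rle R0 c.1 /\ S c.2) /\
    Rsum l (fun c => c.1) = R1 /\
    (forall p : 'S_k, v p = Rsum l (fun c => Rmult c.1 (c.2 p))).

Definition cycle_polytope (k : nat) (v : vec k) : Prop :=
  conv_hull (fun x : vec k => exists w : seq 'S_k,
                is_simple_cycle w /\ forall p, x p = cycle_vec w p) v.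

Definition is_vertex (k : nat) (P : vec k -> Prop) (x : vec k) : Prop :=
  P x /\
  forall (y z : vec k) (t : R), P y -> P z -> Rlt R0 t /\ Rlt t R1 ->
    (forall p, x p = Rplus (Rmult t (y p)) (Rmult (Rminus R1 t) (z p))) ->
    forall p, y p = z p.

Definition aff_indep (k : nat) (l : seq (vec k)) : Prop :=
  forall lam : nat -> R,
    Rsum (iota 0 (size l)) lam = R0 ->
    (forall p : 'S_k,
        Rsum (iota 0 (size l)) (fun i => Rmult (lam i) (nth (fun _ => R0) l i p)) = R0) ->
    forall i, (i < size l)%N -> lam i = R0.

(* The affine span of S has dimension d (for non-empty S): S contains d+1
   affinely independent points but not d+2. *)
Definition has_dim (k : nat) (S : vec k -> Prop) (d : nat) : Prop :=
  (exists l : seq (vec k), size l = d.+1 /\ (forall x, List.In x l -> S x) /\ aff_indep l) /\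
  (forall l : seq (vec k), size l = d.+2 -> (forall x, List.In x l -> S x) -> ~ aff_indep l).

(* Main.v *)
From Stdlib Require Import Reals.
From mathcomp Require Import all_fingroup all_boot all_order all_algebra.
From mathcomp Require Import boolp Rstruct.
From mathcomp Require Import lra ring zify.
Require Import Defs.
Set Implicit Arguments.
Unset Strict Implicit.
Unset Printing Implicit Defensive.
Import Order.TTheory GRing.Theory Num.Theory.

(* The consecutive patterns of a permutation, read from left to right, form a
   walk of the overlap graph, and every walk arises in this way. Hence c-occ
   counts the edge traversals of a walk, and P_k is the set of limits of edge
   frequencies of long walks. Such a limit is a unit flow, since a walk enters
   and leaves each vertex equally often up to one unit. Conversely a unit flow
   is a convex combination of simple cycles; as the overlap graph is strongly
   connected (walk along a direct sum of two permutations), repeating each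
   cycle in proportion to its weight and joining the repetitions by walks of
   bounded length gives walks whose frequencies converge to the flow.
   A unit flow carried by a simple cycle is constant along it, which gives the
   vertices. The dimension is a rank computation: potentials constant along all
   edges of a connected graph are constant, and the uniform flow is interior. *)

(** * Flows and cycles in directed multigraphs *)

Lemma uniq_map_inj (T1 T2 : eqType) (f : T1 -> T2) (s : seq T1) :
  uniq (map f s) -> {in s &, injective f}.
Proof.
elim: s => [|x s IH] //= /andP[xs /IH sI] y z.
rewrite !inE => /orP[/eqP->|ys] /orP[/eqP->|zs] // fyz; last exact: sI.
  by case/mapP: xs; exists z.
by case/mapP: xs; exists y.
Qed.

Lemma sum_count_mem_pred (T : finType) (P : pred T) (s : seq T) :
  (\sum_(x | P x) count_mem x s = count P s)%N.
Proof.
elim: s => [|y s IH] /=; first by rewrite big1.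
rewrite big_split /= IH; congr (_ + _)%N.
case Py: (P y).
  by rewrite (bigD1 y) //= eqxx big1 // => x /andP[_ /negPf]; rewrite eq_sym => ->.
by rewrite big1 // => x Px; case: eqP => // yx; rewrite yx Px in Py.
Qed.

Section Walks.
Variables (V E : finType) (st ar : E -> V).

(** Both endpoints are arguments, so that the empty walk has a vertex and concatenation needs no
    case distinction. *)
Fixpoint walk (x : V) (w : seq E) (y : V) : bool :=
  if w is e :: w' then (st e == x) && walk (ar e) w' y else x == y.

Lemma walk_cat x y z w1 w2 :
  walk x w1 y -> walk y w2 z -> walk x (w1 ++ w2) z.
Proof.
elim: w1 x => [|e w1 IH] x /=; first by move/eqP->.
by case/andP=> -> /IH.
Qed.

Lemma walk_flatten_nseq x w n : walk x w x -> walk x (flatten (nseq n w)) x.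
Proof. by move=> wx; elim: n => [|n IH] /=; rewrite ?eqxx //; apply: walk_cat IH. Qed.

(** Inner visits to z enter and leave once each; only the two endpoints can break the balance. The
    additive form avoids truncated subtraction. *)
Lemma walk_balance x y w z : walk x w y ->
  (count (fun e => st e == z) w + (y == z) =
   count (fun e => ar e == z) w + (x == z))%N.
Proof.
elim: w x => [|e w IH] x /=; first by move/eqP->.
by case/andP=> /eqP<- /IH; lia.
Qed.

(** On a closed walk the arrivals are a rotation of the starts, so distinct starts already force
    distinct arrivals and distinct edges. *)
Definition simple_cycle (w : seq E) : bool :=
  [&& w != [::], cycle [rel e f | ar e == st f] w & uniq (map st w)].

Lemma path_walk e w f :
  path [rel e f | ar e == st f] e (rcons w f) = walk (ar e) w (st f).
Proof.
elim: w e => [|g w IH] e /=; first by rewrite andbT.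
by rewrite IH eq_sym.
Qed.

Lemma simple_cycle_walk w : simple_cycle w -> exists x, walk x w x.
Proof.
case: w => [|e w] // /and3P[_ + _]; rewrite [cycle _ _]path_walk => we.
by exists (st e); rewrite /= eqxx.
Qed.

Lemma simple_cycle_uniq w : simple_cycle w -> uniq w.
Proof. by case/and3P=> _ _; apply: map_uniq. Qed.

Lemma simple_cycle_st_inj w : simple_cycle w -> {in w &, injective st}.
Proof. by case/and3P=> _ _; apply: uniq_map_inj. Qed.

Lemma simple_cycle_ar_inj w : simple_cycle w -> {in w &, injective ar}.
Proof.
move=> wC e f ew fw aref; have [_ wcyc _] := and3P wC.
rewrite -(prev_next (simple_cycle_uniq wC) e) -(prev_next (simple_cycle_uniq wC) f).
congr (prev w _); apply: (simple_cycle_st_inj wC); rewrite ?mem_next //.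
by rewrite -(eqP (next_cycle wcyc ew)) -(eqP (next_cycle wcyc fw)).
Qed.

Local Open Scope ring_scope.
Variable R : archiRealFieldType.
Implicit Types u v : E -> R.

Definition cycle_weight (w : seq E) (e : E) : R :=
  (count_mem e w)%:R / (size w)%:R.

Definition balanced v :=
  forall x, \sum_(e | st e == x) v e = \sum_(e | ar e == x) v e.

Record flow v : Prop := Flow {
  flow_ge0 : forall e, 0 <= v e;
  flow_sum : \sum_e v e = 1;
  flow_balanced : balanced v }.

Lemma flow_le1 v e : flow v -> v e <= 1.
Proof.
move=> vF; rewrite -(flow_sum vF) (bigD1 e) //= lerDl.
by apply: sumr_ge0 => *; apply: flow_ge0.
Qed.

Lemma balanced_lincomb a b u v : balanced u -> balanced v ->
  balanced (fun e => a * u e + b * v e).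
Proof. by move=> ub vb x; rewrite !big_split /= -!mulr_sumr ub vb. Qed.

Lemma sum_cycle_weight P w :
  \sum_(e | P e) cycle_weight w e = (count P w)%:R / (size w)%:R.
Proof. by rewrite -mulr_suml -natr_sum sum_count_mem_pred. Qed.

Lemma cycle_weight_ge0 w e : 0 <= cycle_weight w e.
Proof. by rewrite divr_ge0. Qed.

Lemma simple_cycle_size w : simple_cycle w -> (0 < size w)%N.
Proof. by case: w. Qed.

Lemma cycle_weight_flow w : simple_cycle w -> flow (cycle_weight w).
Proof.
move=> wC; split; first exact: cycle_weight_ge0.
- by rewrite sum_cycle_weight count_predT divff // pnatr_eq0 -lt0n simple_cycle_size.
- case: (simple_cycle_walk wC) => y wy x.
  by rewrite !sum_cycle_weight (addIn (walk_balance x wy)).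
Qed.

Lemma cycle_weight_mem w e : simple_cycle w ->
  cycle_weight w e = (e \in w)%:R / (size w)%:R.
Proof. by move=> wC; rewrite /cycle_weight count_uniq_mem ?simple_cycle_uniq. Qed.

(* Following an outgoing edge of positive weight from the endpoint of the
   current one eventually loops; as the edge chosen depends only on that
   endpoint, the loop visits no vertex twice. *)
Lemma exists_simple_cycle v : (forall e, 0 <= v e) -> balanced v ->
  (exists e, 0 < v e) ->
  exists2 w, simple_cycle w & {in w, forall e, 0 < v e}.
Proof.
move=> v_ge0 vb [e0 e0_gt0].
pose nxt e := odflt e0 [pick f | (st f == ar e) && (0 < v f)].
have nxtP e : 0 < v e -> (st (nxt e) == ar e) && (0 < v (nxt e)).
  move=> ve; rewrite /nxt; case: pickP => //= noout.
  have : 0 < \sum_(f | st f == ar e) v f.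
    rewrite vb (bigD1 e) //=; apply: ltr_wpDr => //.
    by apply: sumr_ge0 => *.
  rewrite big1 ?ltxx // => f /eqP fe; apply: le_anti; rewrite v_ge0 andbT leNgt.
  by have := noout f; rewrite fe eqxx /= => ->.
have iter_gt0 n : 0 < v (iter n nxt e0).
  by elim: n => //= n /nxtP/andP[].
have [n [k nk]] : exists n k, iter k.+1 nxt (iter n nxt e0) = iter n nxt e0.
  have /loopingP/(_ (order nxt e0))/trajectP[i lti loop] := looping_order nxt e0.
  exists i, (order nxt e0 - i).-1; rewrite prednK ?subn_gt0 //.
  by rewrite -iterD subnK // ltnW.
set y := iter n nxt e0 in nk; pose w := orbit nxt y.
have wcyc : fcycle nxt w by apply/(orbitPcycle 0 3); exists k.
have w_gt0 : {in w, forall e, 0 < v e}.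
  by move=> e; rewrite -fconnect_orbit => /iter_findex <-; rewrite -iterD.
exists w => //; apply/and3P; split.
- by rewrite -size_eq0 size_orbit -lt0n order_gt0.
- apply: (sub_in_cycle _ (introT allP w_gt0)) wcyc => e f e_gt0 _ /eqP <- /=.
  by case/andP: (nxtP _ e_gt0) => /eqP->.
- rewrite map_inj_in_uniq ?orbit_uniq // => e f we wf.
  have prevE g : g \in w -> 0 < v (prev w g) /\ nxt (prev w g) = g.
    by move=> wg; rewrite w_gt0 ?mem_prev // (eqP (prev_cycle wcyc wg)).
  have [e_gt0 eE] := prevE e we; have [f_gt0 fE] := prevE f wf.
  have [/eqP stE _] := andP (nxtP _ e_gt0); have [/eqP stF _] := andP (nxtP _ f_gt0).
  move=> ef; rewrite -eE -fE /nxt; rewrite eE in stE; rewrite fE in stF.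
  by rewrite -stE -stF ef.
Qed.

(** Take a to be the length of the cycle times the minimum of v on it: subtracting that multiple
    keeps v nonnegative and empties the edge attaining the minimum. *)
Lemma peel_simple_cycle v : (forall e, 0 <= v e) -> balanced v ->
  (exists e, 0 < v e) ->
  exists w a, [/\ simple_cycle w, 0 < a, forall e, a * cycle_weight w e <= v e
    & exists2 e, 0 < v e & v e = a * cycle_weight w e].
Proof.
move=> v_ge0 vb /(exists_simple_cycle v_ge0 vb)[w wC w_gt0].
have [f0 wf0] : exists f, f \in w.
  by case: w wC {w_gt0} => // f w _; exists f; rewrite mem_head.
have [f wf fmin] := @arg_minP _ _ _ f0 (mem w) v wf0.
have sw_gt0 : 0 < (size w)%:R :> R by rewrite ltr0n simple_cycle_size.
have cwE e : v f * (size w)%:R * cycle_weight w e = v f * (e \in w)%:R.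
  by rewrite cycle_weight_mem // mulrCA mulfK ?gt_eqF // mulrC.
exists w, (v f * (size w)%:R); split => //.
- by rewrite mulr_gt0 ?w_gt0.
- move=> e; rewrite cwE; case: (boolP (e \in w)) => [we|_].
    by rewrite mulr1; apply: fmin.
  by rewrite mulr0.
- by exists f; rewrite ?w_gt0 // cwE (wf : f \in w) mulr1.
Qed.

(** Induction on the size of the support, which each peeled cycle strictly shrinks. *)
Lemma cycle_decomposition v : (forall e, 0 <= v e) -> balanced v ->
  exists2 l : seq (R * seq E),
    {in l, forall c, 0 <= c.1 /\ simple_cycle c.2}
    & forall e, v e = \sum_(c <- l) c.1 * cycle_weight c.2 e.
Proof.
have [n] := ubnP #|[pred e | 0 < v e]|; elim: n v => // n IH v.
rewrite ltnS => supp v_ge0 vb.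
case: (pickP [pred e | 0 < v e]) => [e0 e0_gt0|v0]; last first.
  exists [::] => // e; rewrite big_nil; apply: le_anti.
  by rewrite v_ge0 leNgt; have /= -> := v0 e.
have [|w [a [wC a_gt0 wle [f f_gt0 fE]]]] := peel_simple_cycle v_ge0 vb.
  by exists e0.
(* The factor 1 gives the remainder the shape expected by [balanced_lincomb]. *)
pose u e := 1 * v e + - a * cycle_weight w e.
have uE e : u e = v e - a * cycle_weight w e by rewrite /u mul1r mulNr.
have u_ge0 e : 0 <= u e by rewrite uE subr_ge0.
have [|//||l lP lE] := IH u.
- apply: leq_trans supp; apply: proper_card; apply/properP; split.
    apply/subsetP => e; rewrite !inE uE => /lt_le_trans; apply.
    by rewrite gerBl mulr_ge0 ?cycle_weight_ge0 // ltW.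
  by exists f; rewrite !inE // uE -fE subrr ltxx.
- exact: balanced_lincomb vb (flow_balanced (cycle_weight_flow wC)).
exists ((a, w) :: l) => [c|e].
  by rewrite inE => /orP[/eqP->|/lP//]; rewrite ltW.
by rewrite big_cons -lE uE addrC subrK.
Qed.

(** At the vertex between consecutive edges e and f of the cycle, only e enters and only f leaves
    within the support, so balance gives equal values. The total 1 then fixes the common value as
    the inverse length. *)
Lemma flow_supported_on_cycle w v : simple_cycle w -> flow v ->
  (forall e, e \notin w -> v e = 0) -> v =1 cycle_weight w.
Proof.
move=> wC vF v0; have [_ wcyc _] := and3P wC.
have v_step e f : e \in w -> f \in w -> ar e == st f -> v e = v f.
  move=> we wf /eqP aref; have := flow_balanced vF (st f).
  rewrite (bigD1 f) //= big1 ?addr0 => [->|g /andP[/eqP gf]]; last first.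
    by case: (boolP (g \in w)) => [wg|/v0//]; rewrite (simple_cycle_st_inj wC wg wf gf) eqxx.
  rewrite (bigD1 e) ?aref //= big1 ?addr0 // => g /andP[/eqP ge].
  case: (boolP (g \in w)) => [wg|/v0//].
  by rewrite -aref in ge; rewrite (simple_cycle_ar_inj wC wg we ge) eqxx.
have [e0 v_const] : exists e0, {in w, forall e, v e = v e0}.
  case: w wC v0 wcyc v_step => // e0 w wC _ wcyc v_step; exists e0.
  have : cycle [rel e f | v e == v f] (e0 :: w).
    apply: (@sub_in_cycle _ (mem (e0 :: w))) wcyc; last exact/allP.
    by move=> e f we wf /= /(v_step e f we wf)/eqP.
  have v_trans : transitive [rel e f | v e == v f] by move=> x y z /= /eqP-> /eqP->.
  move=> /(order_path_min v_trans)/allP v_all e we; apply/eqP; rewrite eq_sym.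
  by apply: v_all; rewrite mem_rcons.
have sw_neq0 : (size w)%:R != 0 :> R by rewrite pnatr_eq0 -lt0n simple_cycle_size.
have vE e : v e = v e0 * (e \in w)%:R.
  by case: (boolP (e \in w)) => [/v_const->|/v0->]; rewrite ?mulr1 ?mulr0.
suff v0E : v e0 = (size w)%:R^-1 by move=> e; rewrite vE v0E cycle_weight_mem // mulrC.
apply: (mulIf sw_neq0); rewrite mulVf // -[RHS](flow_sum vF).
rewrite (eq_bigr _ (fun e _ => vE e)) -mulr_sumr -natr_sum; congr (_ * _%:R).
rewrite -(count_predT w) -sum_count_mem_pred.
by apply: eq_bigr => e _; rewrite count_uniq_mem ?simple_cycle_uniq.
Qed.

(** Off the cycle, a combination of nonnegative values with positive coefficients vanishes, so both
    flows are carried by the cycle and [flow_supported_on_cycle] determines them. *)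
Lemma cycle_weight_extreme w u v t : simple_cycle w -> flow u -> flow v ->
  0 < t < 1 -> (forall e, cycle_weight w e = t * u e + (1 - t) * v e) -> u =1 v.
Proof.
move=> wC uF vF /andP[t_gt0 t_lt1] wE.
have t'_gt0 : 0 < 1 - t by rewrite subr_gt0.
have uv0 e : e \notin w -> u e = 0 /\ v e = 0.
  move=> /negPf ew; have /eqP := wE e; rewrite cycle_weight_mem // ew mul0r eq_sym.
  rewrite paddr_eq0; last 2 first.
  - by apply: mulr_ge0; [apply: ltW|apply: flow_ge0].
  - by apply: mulr_ge0; [apply: ltW|apply: flow_ge0].
  by rewrite !mulf_eq0 (gt_eqF t_gt0) (gt_eqF t'_gt0) /= => /andP[/eqP-> /eqP->].
move=> e; rewrite (flow_supported_on_cycle wC uF) ?(flow_supported_on_cycle wC vF) //.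
  by move=> f /uv0[].
by move=> f /uv0[].
Qed.

(** Peel off a times a cycle weight. If a = 1, the remainder is nonnegative with sum 0, hence zero.
    Otherwise the rescaled remainder z is a flow, v lies strictly between the cycle weight and z,
    and extremality identifies the two. *)
Lemma extreme_cycle_weight v : flow v ->
  (forall y z t, flow y -> flow z -> 0 < t < 1 ->
     (forall e, v e = t * y e + (1 - t) * z e) -> y =1 z) ->
  exists2 w, simple_cycle w & v =1 cycle_weight w.
Proof.
move=> vF v_ext; have [v_ge0 v_sum vb] := vF.
have [|w [a [wC a_gt0 wle _]]] := peel_simple_cycle v_ge0 vb.
  suff /existsP[e e_gt0] : [exists e, 0 < v e] by exists e.
  apply: contraT => /existsPn v0; suff /eqP : (1 : R) = 0 by rewrite oner_eq0.
  by rewrite -v_sum big1 // => e _; apply: le_anti; rewrite v_ge0 leNgt v0.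
have [_ w_sum wb] := cycle_weight_flow wC; exists w => // e.
have sumB : \sum_e (v e - a * cycle_weight w e) = 1 - a.
  by rewrite sumrB v_sum -mulr_sumr w_sum mulr1.
have a_le1 : a <= 1.
  by rewrite -subr_ge0 -sumB; apply: sumr_ge0 => f _; rewrite subr_ge0.
have [a1|a_neq1] := eqVneq a 1.
  have := psumr_eq0P (P := predT) (F := fun e => v e - a * cycle_weight w e).
  move=> /(_ _ _ e isT)/eqP; rewrite subr_eq0 sumB a1 subrr mul1r => H.
  by apply/eqP; apply: H => // f _; rewrite -{1}a1 subr_ge0.
have a'_gt0 : 0 < 1 - a by rewrite subr_gt0 lt_neqAle a_neq1.
pose z e := (1 - a)^-1 * v e + (- (a / (1 - a))) * cycle_weight w e.
have zE f : z f = (v f - a * cycle_weight w f) / (1 - a).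
  by rewrite /z mulNr mulrC mulrAC -mulrBl.
have zF : flow z.
  split; last exact: balanced_lincomb vb wb.
    by move=> f; rewrite zE divr_ge0 ?subr_ge0 // ltW.
  by rewrite (eq_bigr _ (fun f _ => zE f)) -mulr_suml sumB divff // gt_eqF.
have vE f : v f = a * cycle_weight w f + (1 - a) * z f.
  by rewrite zE [(1 - a) * _]mulrC mulfVK ?gt_eqF // addrC subrK.
have wz : cycle_weight w =1 z.
  apply: (v_ext _ _ a (cycle_weight_flow wC) zF) => //.
  by rewrite a_gt0 lt_neqAle a_neq1.
by rewrite vE -wz -mulrDl addrC subrK mul1r.
Qed.

(** * Approximation of a flow by long walks in a strongly connected graph *)

Section StronglyConnected.
Variable L : nat.
Hypothesis walk_ex : forall x y, exists2 w, walk x w y & (size w <= L)%N.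

(** The bound C is uniform in m: each cycle of the decomposition costs at most L for the walk
    leading to it and its own length for rounding the number of turns. Arbitrary endpoints let the
    induction chain the pieces. *)
Lemma flow_approx v : flow v ->
  exists C : R, forall (m : nat) x y, exists2 w, walk x w y &
    forall e, `|(count_mem e w)%:R - m%:R * v e| <= C.
Proof.
case=> v_ge0 _ vb; have [l lP vE] := cycle_decomposition v_ge0 vb.
(* The induction runs over the decomposition; its partial sums need not have total 1, so v is
   replaced by the explicit sum. *)
suff [C CP] : exists C : R, forall (m : nat) x y, exists2 w, walk x w y &
    forall e, `|(count_mem e w)%:R - m%:R * \sum_(c <- l) c.1 * cycle_weight c.2 e| <= C.
  exists C => m x y; have [w wP wC] := CP m x y; exists w => // e.
  by rewrite vE.
elim: l lP {v v_ge0 vb vE} => [_|[a w0] l IH lP].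
  exists L%:R => m x y; have [w wP wL] := walk_ex x y; exists w => // e.
  rewrite big_nil mulr0 subr0 ger0_norm // ler_nat.
  exact: leq_trans (count_size _ _) wL.
have [|C CP] := IH; first by move=> c cl; apply: lP; rewrite inE cl orbT.
have [/= a_ge0 wC] := lP (a, w0) (mem_head _ _).
have [z wz] := simple_cycle_walk wC.
exists (L%:R + (size w0)%:R + C) => m x y.
have [w1 w1P w1L] := walk_ex x z; have [w2 w2P w2C] := CP m z y.
have sw_gt0 : 0 < (size w0)%:R :> R by rewrite ltr0n simple_cycle_size.
(* Exactly q turns would contribute the desired m * a * [cycle_weight]; truncation loses less than
   one turn. *)
pose q := m%:R * a / (size w0)%:R; pose N := Num.truncn q.
have q_ge0 : 0 <= q by rewrite divr_ge0 ?mulr_ge0.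
exists (w1 ++ flatten (nseq N w0) ++ w2) => [|e].
  exact: walk_cat w1P (walk_cat (walk_flatten_nseq N wz) w2P).
rewrite big_cons /= mulrDr !count_cat !natrD count_flatten map_nseq sumn_nseq natrM.
have -> : m%:R * (a * cycle_weight w0 e) = (count_mem e w0)%:R * q.
  by rewrite /q /cycle_weight; ring.
have /andP[Nq qN] := truncn_itv q_ge0; rewrite -/N -natr1 in Nq qN.
have := w2C e; have : (count_mem e w1)%:R <= L%:R :> R.
  by rewrite ler_nat (leq_trans (count_size _ _)).
have : (count_mem e w0)%:R <= (size w0)%:R :> R by rewrite ler_nat count_size.
have : 0 <= (count_mem e w1)%:R :> R by [].
have : 0 <= (count_mem e w0)%:R :> R by [].
move: (count_mem e w0)%:R (count_mem e w1)%:R (count_mem e w2)%:R => c0 c1 c2.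
move: (\sum_(_ <- _) _) => S c0_ge0 c1_ge0 c0_le c1_le; rewrite !ler_norml.
have : c0 * N%:R <= c0 * q by rewrite ler_wpM2l.
have : c0 * q <= c0 * N%:R + c0 by rewrite -{3}[c0]mulr1 -mulrDr ler_wpM2l // ltW.
by lra.
Qed.

(** * The dimension of the set of flows *)

Lemma potential_const (T : Type) (h : V -> T) :
  (forall e, h (st e) = h (ar e)) -> forall x y, h x = h y.
Proof.
move=> hE x y; have [w + _] := walk_ex x y.
by elim: w x => [|e w IH] x /=; [move/eqP-> | case/andP=> /eqP<- /IH; rewrite hE].
Qed.

(* The equations defining the linear directions of the set of flows; its last
   column is the condition that the coordinates sum to zero. *)
Definition flow_mx : 'M[R]_(#|E|, #|V| + 1) :=
  row_mx (\matrix_(i, j) ((st (enum_val i) == enum_val j)%:R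
                          - (ar (enum_val i) == enum_val j)%:R))
         (const_mx 1).

Lemma mul_flow_mxP (d : 'rV[R]_#|E|) :
  d *m flow_mx = 0 <->
  balanced (fun e => d 0 (enum_rank e)) /\ \sum_e d 0 (enum_rank e) = 0.
Proof.
have sumE (F : 'I_#|E| -> R) : \sum_i F i = \sum_e F (enum_rank e).
  by rewrite (reindex _ (onW_bij _ (enum_rank_bij E))).
have -> : \sum_e d 0 (enum_rank e) = (d *m const_mx 1 : 'rV_1) 0 0.
  by rewrite mxE sumE; apply: eq_bigr => e _; rewrite mxE mulr1.
have dE x : \sum_(e | st e == x) d 0 (enum_rank e) - \sum_(e | ar e == x) d 0 (enum_rank e)
    = (d *m lsubmx flow_mx) 0 (enum_rank x).
  rewrite row_mxKl mxE sumE big_mkcond [X in _ - X]big_mkcond -sumrB.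
  apply: eq_bigr => e _; rewrite mxE !enum_rankK.
  by do 2!case: (_ == _); rewrite ?mulr1n ?mulr0n; ring.
rewrite -[flow_mx in X in X <-> _]hsubmxK mul_mx_row row_mxKr.
split=> [|[db d1]].
  rewrite -[0]hsubmxK => /eq_row_mx[/rowP d0 /rowP d1]; split; last first.
    by rewrite d1 linear0 mxE.
  by move=> x; apply/eqP; rewrite -subr_eq0 dE d0 linear0 mxE.
rewrite -[0]hsubmxK !linear0; congr row_mx; apply/rowP => i.
  by rewrite -[i]enum_valK -dE db subrr mxE.
by rewrite !ord1 d1 mxE.
Qed.

(** A row in the kernel of the transpose is a potential h with a scalar c such that h (st e) - h (ar
    e) + c = 0 on every edge. The loop forces c = 0, then h is constant by connectivity: the kernel
    is the line spanned by r. *)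
Lemma rank_flow_mx (e0 : E) : st e0 = ar e0 -> \rank flow_mx = #|V|.
Proof.
move=> loop; rewrite -mxrank_tr.
suff : \rank (kermx flow_mx^T) = 1%N.
  rewrite mxrank_ker; move: (rank_leq_row flow_mx^T); set rk := \rank _; move: rk #|V| => rk n; lia.
pose r : 'rV[R]_(#|V| + 1) := row_mx (const_mx 1) 0.
have r_neq0 : r != 0.
  apply/eqP => /rowP/(_ (lshift 1 (enum_rank (st e0))))/eqP.
  by rewrite row_mxEl !mxE oner_eq0.
suff /eqmxP -> : (kermx flow_mx^T == r)%MS by rewrite rank_rV r_neq0.
have mulE (u : 'rV[R]_(#|V| + 1)) e : (u *m flow_mx^T) 0 (enum_rank e) =
  u 0 (lshift 1 (enum_rank (st e))) - u 0 (lshift 1 (enum_rank (ar e))) + u 0 (rshift _ 0).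
  rewrite mxE big_split_ord big_ord1 /=; congr (_ + _); last first.
    by rewrite mxE row_mxEr mxE mulr1.
  under eq_bigr => j _ do rewrite mxE row_mxEl mxE enum_rankK mulrBr.
  rewrite sumrB; congr (_ - _).
    rewrite (bigD1 (enum_rank (st e))) //= enum_rankK eqxx mulr1 big1 ?addr0 // => j.
    by rewrite -{1}[j]enum_valK (inj_eq enum_rank_inj) eq_sym => /negPf->; rewrite mulr0.
  rewrite (bigD1 (enum_rank (ar e))) //= enum_rankK eqxx mulr1 big1 ?addr0 // => j.
  by rewrite -{1}[j]enum_valK (inj_eq enum_rank_inj) eq_sym => /negPf->; rewrite mulr0.
apply/andP; split; last first.
  apply/sub_kermxP/rowP => i; rewrite -[i]enum_valK mulE.
  by rewrite !row_mxEl row_mxEr !mxE subrr addr0.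
apply/row_subP => i; set u := row i _.
have : u *m flow_mx^T = 0 by apply/sub_kermxP; rewrite row_sub.
move=> u0; have {}mulE e : u 0 (lshift 1 (enum_rank (st e)))
    - u 0 (lshift 1 (enum_rank (ar e))) + u 0 (rshift _ 0) = 0.
  by rewrite -mulE u0 mxE.
have uR : u 0 (rshift _ 0) = 0 by have := mulE e0; rewrite loop subrr add0r.
have uL := potential_const (h := fun x => u 0 (lshift 1 (enum_rank x))).
have {}uL x y : u 0 (lshift 1 (enum_rank x)) = u 0 (lshift 1 (enum_rank y)).
  by apply: uL => e; have /eqP := mulE e; rewrite uR addr0 subr_eq0 => /eqP.
have -> : u = u 0 (lshift 1 (enum_rank (st e0))) *: r; last exact: scalemx_sub.
apply/rowP => j; rewrite [RHS]mxE; case: (split_ordP j) => {}j ->.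
  by rewrite row_mxEl [const_mx _ _ _]mxE mulr1 -{1}[j]enum_valK (uL _ (st e0)).
by rewrite row_mxEr [X in _ * X]mxE mulr0 ord1.
Qed.

Lemma rank_ker_flow_mx (e0 : E) : st e0 = ar e0 ->
  \rank (kermx flow_mx) = (#|E| - #|V|)%N.
Proof. by move=> loop; rewrite mxrank_ker (rank_flow_mx loop). Qed.

(** The d + 1 differences from the first flow lie in the kernel of [flow_mx], of dimension d, so
    they are linearly dependent; the coefficient of the first flow is chosen to make the sum
    zero. *)
Lemma flow_aff_dep (e0 : E) (x : nat -> E -> R) : st e0 = ar e0 ->
  let d := (#|E| - #|V|)%N in
  (forall i, (i < d.+2)%N -> flow (x i)) ->
  exists lam : nat -> R, [/\ \sum_(i < d.+2) lam i = 0,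
    forall e, \sum_(i < d.+2) lam i * x i e = 0
    & exists2 i, (i < d.+2)%N & lam i != 0].
Proof.
move=> loop d xF.
pose Y := \matrix_(i < d.+1, j < #|E|) (x i.+1 (enum_val j) - x 0%N (enum_val j)).
have YE i e : Y i (enum_rank e) = x i.+1 e - x 0%N e by rewrite mxE enum_rankK.
have Yker : Y *m flow_mx = 0.
  apply/row_matrixP => i; rewrite row_mul row0; apply/mul_flow_mxP.
  have [_ x_sum xb] := xF i.+1 (ltn_ord i); have [_ x0_sum x0b] := xF 0%N isT.
  have rE e : row i Y 0 (enum_rank e) = x i.+1 e - x 0%N e by rewrite mxE YE.
  split=> [z|]; last by rewrite (eq_bigr _ (fun e _ => rE e)) sumrB x_sum x0_sum subrr.
  by rewrite !(eq_bigr _ (fun e _ => rE e)) !sumrB xb x0b.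
have /rowV0Pn[mu /sub_kermxP muY mu_neq0] : kermx Y != 0.
  rewrite -mxrank_eq0 mxrank_ker subn_eq0 -ltnNge ltnS.
  apply: (@leq_trans (\rank (kermx flow_mx))); last by rewrite (rank_ker_flow_mx loop).
  exact/mxrankS/sub_kermxP.
have muE e : \sum_(i < d.+1) mu 0 i * (x i.+1 e - x 0%N e) = 0.
  have /rowP/(_ (enum_rank e)) := muY; rewrite !mxE => muYe.
  by rewrite -[RHS]muYe; apply: eq_bigr => i _; rewrite YE.
exists (fun i => if i is j.+1 then mu 0 (inord j) else - \sum_i mu 0 i); split.
- rewrite big_ord_recl /= addrC; apply/eqP; rewrite subr_eq0; apply/eqP.
  by apply: eq_bigr => i _; rewrite inord_val.
- move=> e; rewrite big_ord_recl /= -[RHS](muE e) addrC mulNr mulr_suml -sumrB.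
  by apply: eq_bigr => i _; rewrite /bump inord_val mulrBr.
have /rV0Pn[i mui] := mu_neq0; exists i.+1; first by rewrite ltnS.
by rewrite inord_val.
Qed.

(* A small ball around the uniform flow, inside its affine hull, consists of flows. *)
Lemma flow_aff_indep (e0 : E) : st e0 = ar e0 -> balanced (fun=> 1) ->
  let d := (#|E| - #|V|)%N in
  exists x : nat -> E -> R, (forall i, flow (x i)) /\
    forall lam : nat -> R, \sum_(i < d.+1) lam i = 0 ->
      (forall e, \sum_(i < d.+1) lam i * x i e = 0) ->
      forall i, (i < d.+1)%N -> lam i = 0.
Proof.
move=> loop unif d; rewrite {}/d -(rank_ker_flow_mx loop).
pose K := row_base (kermx flow_mx); pose r := \rank (kermx flow_mx); rewrite -/r.
have Kker i : row i K *m flow_mx = 0.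
  by apply/sub_kermxP; rewrite (submx_trans (row_sub _ _)) // eq_row_base.
have cE_gt0 : 0 < #|E|%:R :> R by rewrite ltr0n; apply/card_gt0P; exists e0.
(* M bounds every entry of the kernel basis K, and the summand 1 keeps it positive even for an empty
   basis. As eps * M is the uniform weight, moving by eps along a basis vector keeps all coordinates
   nonnegative. *)
pose M := 1 + \sum_(i < r) \sum_e `|K i (enum_rank e)|.
have KM i e : `|K i (enum_rank e)| <= M.
  rewrite /M (bigD1 i) //= (bigD1 e) //= -!addrA [leRHS]addrCA lerDl.
  by rewrite !addr_ge0 ?sumr_ge0 // => j _; rewrite sumr_ge0.
have M_gt0 : 0 < M.
  by rewrite ltr_pwDl // sumr_ge0 // => i _; rewrite sumr_ge0.
pose u : E -> R := fun=> 1 * #|E|%:R^-1; pose eps := #|E|%:R^-1 / M.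
have eps_gt0 : 0 < eps by rewrite divr_gt0 ?invr_gt0.
have uF : flow u.
  split=> [e||x]; first by rewrite /u mul1r invr_ge0.
    by rewrite /u -mulr_suml sumr_const -mulr_natl mulr1 divff ?gt_eqF.
  by rewrite -!mulr_suml unif.
(* Indices beyond the basis default to the uniform flow, so that x i is a flow for every i. *)
pose x i := if i is j.+1 then fun e => 1 * u e + eps *
  (if insub j is Some o then K o (enum_rank e) else 0) else u.
exists x; split=> [[|j] //|lam lam0 lamx].
  rewrite /x; case: insubP => [o _ _|_]; last first.
    by have := uF; congr flow; apply/funext => e; rewrite mulr0 addr0 mul1r.
  have [Kb K0] := (mul_flow_mxP (row o K)).1 (Kker o).
  have rE e : row o K 0 (enum_rank e) = K o (enum_rank e) by rewrite mxE.
  have {}Kb : balanced (fun e => K o (enum_rank e)).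
    by move=> z; have := Kb z; rewrite !(eq_bigr _ (fun e _ => rE e)).
  split; last exact: balanced_lincomb (flow_balanced uF) Kb.
    move=> e; rewrite mul1r /u mul1r -lerBlDl sub0r.
    have := KM o e; rewrite ler_norml => /andP[KMl _].
    have -> : #|E|%:R^-1 = eps * M by rewrite divfK ?gt_eqF.
    by rewrite -mulrN ler_wpM2l // ltW.
  rewrite big_split /= -mulr_sumr (flow_sum uF) -mulr_sumr.
  by rewrite -(eq_bigr _ (fun e _ => rE e)) K0 mulr0 addr0 mulr1.
pose mu : 'rV[R]_r := \row_i lam i.+1.
have lam0E : lam 0%N = - \sum_(i < r) lam i.+1.
  by apply/eqP; rewrite -addr_eq0 -[eqbRHS]lam0 big_ord_recl.
(* Since lam 0 is minus the sum of the others, the uniform parts cancel and the affine relation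
   becomes eps times a linear relation among the basis vectors. *)
have muK : mu *m K = 0.
  apply/rowP => j; rewrite -[j]enum_valK; set e := enum_val j.
  apply: (mulfI (negbT (gt_eqF eps_gt0))).
  rewrite !mxE mulr0 mulr_sumr -[RHS](lamx e) big_ord_recl /= lam0E.
  rewrite mulNr mulr_suml addrC -sumrB; apply: eq_bigr => i _.
  rewrite mxE /bump /= valK /u; ring.
have mu0 : mu = 0.
  by apply: (row_free_inj (row_base_free (kermx flow_mx))); rewrite /= muK mul0mx.
have lamS i : (i < r)%N -> lam i.+1 = 0.
  by move=> ir; have /rowP/(_ (Ordinal ir)) := mu0; rewrite !mxE.
case=> [|i]; last exact: lamS.
by rewrite lam0E big1 ?oppr0 // => i _; apply: lamS.
Qed.
End StronglyConnected.
End Walks.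

(** * Standardization, windows and walks of the overlap graph *)

Lemma perm_rank k (p : 'S_k) (a : 'I_k) : #|[pred b | p b < p a]| = p a.
Proof.
rewrite -sum1_card; transitivity (\sum_(i < k | i < p a) 1).
  by rewrite [RHS](reindex_inj (@perm_inj _ p)).
by rewrite (big_ord_narrow (ltnW (ltn_ord (p a)))) sum1_card card_ord.
Qed.

(** For injective f the rank is below k and strictly increasing in f, hence injective, so neither
    the default of [insubd] nor that of [std] is taken. *)
Lemma std_val k (f : 'I_k -> nat) : injective f ->
  forall a, std f a = #|[pred b | f b < f a]| :> nat.
Proof.
move=> f_inj.
have rk_lt a : #|[pred b | f b < f a]| < k.
  rewrite -[ltnRHS]card_ord; apply: proper_card; apply/properP.
  by split; [apply/subsetP | exists a; rewrite ?inE //= ltnn].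
have std_funE a : std_fun f a = #|[pred b | f b < f a]| :> nat.
  by rewrite /std_fun val_insubd rk_lt.
have rk_mono a b : f a < f b -> std_fun f a < std_fun f b.
  move=> ab; rewrite !std_funE; apply: proper_card; apply/properP; split.
    by apply/subsetP => c; rewrite !inE => /ltn_trans; apply.
  by exists a; rewrite !inE ?ltnn.
have std_fun_inj : injective (std_fun f).
  move=> a b ab; apply: f_inj; have := rk_mono a b; have := rk_mono b a.
  by rewrite ab ltnn; case: ltngtP => // _ H1 H2; [have := H1 isT|have := H2 isT].
move=> a; rewrite -std_funE /std.
(* The match in [std] depends on an equality proof, generalized here before the boolean is
   destructed. *)
move: (erefl _); case: {2 3}(injectiveb _) => inj_eq; first by rewrite permE.
by have /injectiveP := std_fun_inj; rewrite inj_eq.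
Qed.

Lemma std_ltn k (f : 'I_k -> nat) : injective f ->
  forall a b, (std f a < std f b) = (f a < f b).
Proof.
move=> f_inj a b; rewrite !std_val //.
have rk_mono c d : f c < f d -> #|[pred b | f b < f c]| < #|[pred b | f b < f d]|.
  move=> cd; apply: proper_card; apply/properP; split.
    by apply/subsetP => e; rewrite !inE => /ltn_trans; apply.
  by exists c; rewrite !inE ?ltnn.
case: (ltngtP (f a) (f b)) => [/rk_mono->//|/rk_mono/ltnW|/f_inj->]; last by rewrite ltnn.
by rewrite leqNgt => /negPf.
Qed.

(** Both sides are ranks for the same order. The pattern identities below reduce to order
    comparisons through this lemma. *)
Lemma std_unique k (f : 'I_k -> nat) (p : 'S_k) :
  (forall a b, (f a < f b) = (p a < p b)) -> std f = p.
Proof.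
move=> fp; have f_inj : injective f.
  move=> a b ab; apply: (@perm_inj _ p); apply: val_inj => /=.
  by have := fp a b; have := fp b a; rewrite ab ltnn; case: ltngtP.
apply/perm.permP => a; apply: val_inj; rewrite /= std_val // -[RHS]perm_rank.
by apply: eq_card => b; rewrite !inE fp.
Qed.

Lemma eq_std k (f g : 'I_k -> nat) : injective g ->
  (forall a b, (f a < f b) = (g a < g b)) -> std f = std g.
Proof. by move=> g_inj fg; apply: std_unique => a b; rewrite fg std_ltn. Qed.

Lemma pval_ord n (s : 'S_n) (i : 'I_n) : pval s i = s i.
Proof. by rewrite /pval valK. Qed.

Lemma pval_inj n (s : 'S_n) : {in gtn n &, injective (pval s)}.
Proof.
move=> i j; rewrite !inE => ltin ltjn.
rewrite (pval_ord s (Ordinal ltin)) (pval_ord s (Ordinal ltjn)).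
by move=> /val_inj/perm_inj/(congr1 val).
Qed.

(** Patterns are taken of arbitrary functions, so that words can be built by prepending or
    juxtaposing values without renormalizing them. *)
Definition window k (f : nat -> nat) (i : nat) : 'S_k :=
  std (fun a : 'I_k => f (i + a)).

Section Window.
Variables (f : nat -> nat) (n : nat).
Hypothesis f_inj : {in gtn n &, injective f}.

Lemma window_inj k i : i + k <= n -> injective (fun a : 'I_k => f (i + a)).
Proof.
move=> ikn a b /f_inj ab; apply: val_inj; apply: (@addnI i); apply: ab.
  by rewrite inE (leq_trans _ ikn) // ltn_add2l.
by rewrite inE (leq_trans _ ikn) // ltn_add2l.
Qed.

Lemma window_ltn k i : i + k <= n ->
  forall a b, (window k f i a < window k f i b) = (f (i + a) < f (i + b)).
Proof. by move=> ikn a b; rewrite std_ltn //; apply: window_inj. Qed.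

Lemma be_window k i : i + k.+1 <= n -> be (window k.+1 f i) = window k f i.
Proof.
move=> ikn; apply: std_unique => a b.
have lt_w (c : 'I_k) : c < k.+1 by apply: leqW.
rewrite (pval_ord _ (Ordinal (lt_w a))) (pval_ord _ (Ordinal (lt_w b))).
by rewrite !window_ltn // (leq_trans _ ikn) // leq_add2l.
Qed.

Lemma en_window k i : i + k.+1 <= n -> en (window k.+1 f i) = window k f i.+1.
Proof.
move=> ikn; apply: std_unique => a b.
rewrite (pval_ord _ (lift ord0 a)) (pval_ord _ (lift ord0 b)).
by rewrite !window_ltn ?addSnnS // !lift0 !addnS.
Qed.

(** Windows of length k + 1 are the edges; consecutive ones overlap in a window of length k, the
    vertex between them. *)
Lemma window_walk k i m : i + m + k <= n ->
  walk (@be k.+1) (@en k.+1) (window k f i)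
    [seq window k.+1 f j | j <- iota i m] (window k f (i + m)).
Proof.
elim: m i => [|m IH] i imk /=; first by rewrite addn0.
rewrite be_window ?en_window ?eqxx /=; try lia.
by rewrite -addSnnS IH //; lia.
Qed.

End Window.

Lemma eq_window k (f g : nat -> nat) i j :
  injective (fun a : 'I_k => g (j + a)) ->
  (forall a b : 'I_k, (f (i + a) < f (i + b)) = (g (j + a) < g (j + b))) ->
  window k f i = window k g j.
Proof. exact: eq_std. Qed.

Lemma window_pval k (p : 'S_k) : window k (pval p) 0 = p.
Proof. by apply: std_unique => a b; rewrite !add0n !pval_ord. Qed.

(* Prepend a value of the prescribed relative order: doubling makes room
   between the previous values for an odd one. *)
Lemma walk_realization k x w y : walk (@be k.+1) (@en k.+1) x w y ->
  exists f : nat -> nat, [/\ {in gtn (size w + k) &, injective f},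
    window k f 0 = x & [seq window k.+1 f j | j <- iota 0 (size w)] = w].
Proof.
elim: w x => [|e w IH] x /=.
  by exists (pval x); split=> //; [exact: pval_inj | exact: window_pval].
case/andP=> /eqP<- {x} /IH[f [f_inj f0 fw]].
(* t is one more than the largest value that must lie below the new first one, or 0 if there is
   none; hence t <= f a exactly when the new value must be smaller than f a. *)
pose t := \max_(a < k | e (lift ord0 a) < e ord0) (f a).+1.
pose g i := if i is j.+1 then (f j).+1.*2 else t.*2.+1.
have g_inj : {in gtn (size w + k).+1 &, injective g}.
  move=> [|i] [|j] //=; rewrite !inE !ltnS => ltin ltjn; try lia.
  by move/double_inj => [] /f_inj-> //; rewrite inE.
have fe (a b : 'I_k) : (f a < f b) = (e (lift ord0 a) < e (lift ord0 b)).
  have := window_ltn f_inj (leq_addl _ _ : 0 + k <= _) a b.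
  rewrite f0 !add0n => <-.
  rewrite std_ltn ?(pval_ord _ (lift ord0 a)) ?(pval_ord _ (lift ord0 b)) // => c d.
  rewrite (pval_ord _ (lift ord0 c)) (pval_ord _ (lift ord0 d)).
  by move=> /val_inj/perm_inj/lift_inj.
have te (a : 'I_k) : (t < (f a).+1) = (e ord0 < e (lift ord0 a)).
  case: (ltngtP (e ord0) (e (lift ord0 a))) => [ea|ea|/val_inj/perm_inj//].
    rewrite ltnS; apply/bigmax_leqP => b eb; rewrite fe; exact: ltn_trans ea.
  apply/negbTE; rewrite -leqNgt /t (bigD1 a) //=; exact: leq_maxl.
have g0 : window k.+1 g 0 = e.
  apply: std_unique => a b; rewrite !add0n.
  case: (unliftP ord0 a) => [a'|] ->; case: (unliftP ord0 b) => [b'|] ->;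
    rewrite ?lift0 /= ?ltnn //.
  - by rewrite ltn_double ltnS fe.
  - have := te a'; case: (ltngtP (e ord0) (e (lift ord0 a'))) => [_|_|/val_inj/perm_inj//] /=;
    move: (f a') (t) => F T; clear; lia.
  - by rewrite -te; move: (f b') (t) => F T; clear; lia.
exists g; split=> //.
  by rewrite -(be_window g_inj) ?g0 //; lia.
rewrite g0; congr (_ :: _); rewrite -[RHS]fw -[in LHS](addn0 1) iotaDl -map_comp.
apply/eq_in_map => j; rewrite mem_iota add0n /= => ltj.
apply: eq_window => [|a b]; first by apply: (window_inj f_inj); rewrite addnS -addSn leq_add2r.
by rewrite !addSn /= ltn_double ltnS.
Qed.

Lemma overlap_walk_ex k (x y : 'S_k) :
  exists2 w, walk (@be k.+1) (@en k.+1) x w y & (size w <= k)%N.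
Proof.
(* The direct sum: y placed after and above x. Sliding by k positions leads from x to y. *)
pose f i := if i < k then pval x i else k + pval y (i - k).
have pval_lt (p : 'S_k) i : i < k -> pval p i < k.
  by move=> ik; rewrite (pval_ord p (Ordinal ik)) ltn_ord.
have f_inj : {in gtn (k + k) &, injective f}.
  move=> i j; rewrite !inE /f => ltik ltjk.
  case: (ltnP i k) => ik; case: (ltnP j k) => jk.
  - by apply: pval_inj; rewrite inE.
  - by have := pval_lt x i ik; lia.
  - by have := pval_lt x j jk; lia.
  move/addnI/pval_inj; rewrite !inE => H; rewrite -(subnK ik) -(subnK jk).
  by congr (_ + _); apply: H; lia.
have fx : window k f 0 = x.
  by apply: std_unique => a b; rewrite !add0n /f !ltn_ord !pval_ord.
have fy : window k f (0 + k) = y.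
  apply: std_unique => a b; rewrite add0n /f !ltnNge !leq_addr /= !addKn !pval_ord.
  by rewrite leq_add2l.
exists [seq window k.+1 f j | j <- iota 0 k]; last by rewrite size_map size_iota.
by rewrite -fx -fy; apply: (window_walk f_inj).
Qed.

(* Moving the last value to the front turns be into en. *)
Lemma be_en_balanced (R : archiRealFieldType) k :
  balanced (@be k.+1) (@en k.+1) (fun=> 1 : R)%R.
Proof.
move=> x; pose c := perm (@ord_pred_inj k.+1).
rewrite [RHS](reindex_inj (mulgI c)) /=; apply: eq_bigl => p.
congr (_ == x); apply: esym; apply: std_unique => a b.
have lt_w (d : 'I_k) : d < k.+1 by apply: leqW.
have cE (d : 'I_k) : pval (c * p)%g d.+1 = p (Ordinal (lt_w d)).
  rewrite (pval_ord _ (lift ord0 d)) permM permE; congr (val (p _)).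
  by apply: val_inj; rewrite /= add0n modnDr modn_small.
rewrite !cE std_ltn; first by rewrite !(pval_ord p (Ordinal (lt_w _))).
by move=> d e; rewrite !(pval_ord p (Ordinal (lt_w _))) => /val_inj/perm_inj[]/val_inj.
Qed.

(** * The feasible region *)

(** Windows of length k + 1 have n - k starting positions; truncated subtraction gives none when n
    <= k. *)
Definition windows k n (s : 'S_n) : seq 'S_k.+1 :=
  [seq window k.+1 (pval s) j | j <- iota 0 (n - k)].

Lemma c_occ_windows k n (p : 'S_k.+1) (s : 'S_n) :
  c_occ p s = count_mem p (windows k s).
Proof.
rewrite /c_occ -sum1_card; transitivity
  (\sum_(0 <= i < n.+1 | (i + k.+1 <= n) && (window k.+1 (pval s) i == p)) 1).
  by rewrite big_mkord.
rewrite (big_cat_nat (n := n - k)) ?leq0n //=; last by lia.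
rewrite [X in _ + X]big_nat_cond [X in _ + X]big1 ?addn0 => [|i]; last by lia.
rewrite /windows count_map -sum1_count /index_iota subn0.
rewrite big_seq_cond [RHS]big_seq_cond; apply: eq_bigl => i.
rewrite mem_iota add0n /=; case: (ltnP i (n - k)) => //= ink.
by have -> : i + k.+1 <= n by lia.
Qed.

Lemma windows_walk k n (s : 'S_n) : k <= n ->
  walk (@be k.+1) (@en k.+1) (window k (pval s) 0) (windows k s)
    (window k (pval s) (n - k)).
Proof.
move=> kn; rewrite -[X in window _ _ X]add0n.
by apply: (window_walk (@pval_inj _ s)); rewrite add0n subnK.
Qed.

(** Standardizing the whole word that realizes the walk preserves all relative orders, hence every
    window. *)
Lemma perm_realization k x w y : walk (@be k.+1) (@en k.+1) x w y ->
  exists s : 'S_(size w + k), windows k s = w.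
Proof.
case/walk_realization => f [f_inj _ fw]; exists (window (size w + k) f 0).
rewrite -[RHS]fw /windows addnK; apply/eq_in_map => j; rewrite mem_iota add0n /= => ltj.
have jk : j + k.+1 <= size w + k by rewrite addnS -addSn leq_add2r.
apply: eq_window => [|a b]; first exact: (window_inj f_inj).
have lt_w (c : 'I_k.+1) : j + c < size w + k.
  by apply: leq_trans jk; rewrite ltn_add2l.
rewrite (pval_ord _ (Ordinal (lt_w a))) (pval_ord _ (Ordinal (lt_w b))).
by rewrite (window_ltn f_inj).
Qed.

Local Open Scope ring_scope.

(** Once n m exceeds C / eps, the error is below eps. The product form of the bound also makes sense
    when n m = 0. *)
Lemma Un_cv_bounded_error (u : nat -> R) (l C : R) (n : nat -> nat) :
  (forall M, exists N, forall m, (N <= m)%N -> (M <= n m)%N) ->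
  (forall m, `|u m - l| * (n m)%:R <= C) -> Un_cv u l.
Proof.
move=> n_infty uC eps /RltP eps_gt0.
have [N NP] := n_infty (Num.truncn (C / eps)).+1.
exists N => m /ssrnat.leP/NP Mm; apply/RltP; rewrite RdistE ltNge; apply/negP => le_eps.
have : C / eps < (n m)%:R.
  by apply: lt_le_trans (truncnS_gt _) _; rewrite ler_nat.
rewrite ltr_pdivrMr // mulrC ltNge => /negP; apply.
by apply: le_trans (uC m); rewrite ler_wpM2r.
Qed.

Lemma Un_cv_sum (I : Type) (r : seq I) (P : pred I) (u : I -> nat -> R) (l : I -> R) :
  (forall i, Un_cv (u i) (l i)) ->
  Un_cv (fun m => \sum_(i <- r | P i) u i m) (\sum_(i <- r | P i) l i).
Proof.
move=> ul; elim: r => [|i r IH].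
  rewrite big_nil; have -> : (fun m => \sum_(i <- [::] | P i) u i m) = fun=> 0.
    by apply/funext => m; rewrite big_nil.
  by move=> eps eps_gt0; exists 0%N => m _; rewrite /Rdist Rminus_diag Rabs_R0.
rewrite big_cons; case: ifP => Pi.
  have -> : (fun m => \sum_(j <- i :: r | P j) u j m) =
            (fun m => u i m + \sum_(j <- r | P j) u j m).
    by apply/funext => m; rewrite big_cons Pi.
  exact: CV_plus.
suff -> : (fun m => \sum_(j <- i :: r | P j) u j m) =
          (fun m => \sum_(j <- r | P j) u j m) by [].
by apply/funext => m; rewrite big_cons Pi.
Qed.

Section Region.
Variable k : nat.
Implicit Types v : vec k.+1.
Local Notation st := (@be k.+1).
Local Notation ar := (@en k.+1).
Local Notation flow := (@flow _ _ st ar R).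

Lemma c_occ_propE n (p : 'S_k.+1) (s : 'S_n) :
  c_occ_prop p s = (count_mem p (windows k s))%:R / n%:R.
Proof. by rewrite /c_occ_prop RdivE !INRE c_occ_windows. Qed.

Lemma sum_c_occ_prop P n (s : 'S_n) :
  \sum_(p | P p) c_occ_prop p s = (count P (windows k s))%:R / n%:R.
Proof.
under eq_bigr => p _ do rewrite c_occ_propE.
by rewrite -mulr_suml -natr_sum sum_count_mem_pred.
Qed.

(** Equality holds for positive n; the inequality also covers n = 0, where the left side is 0. *)
Lemma divr_nat_error (a b : R) (n : nat) :
  `|a / n%:R - b| * n%:R <= `|a - b * n%:R|.
Proof.
case: n => [|n]; first by rewrite mulr0.
by rewrite -[X in _ * X]ger0_norm // -normrM mulrBl divfK ?pnatr_eq0.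
Qed.

(** Before division by n, the total count differs from n by at most k, and the counts into and out
    of a vertex differ by at most 1. Both errors vanish in the limit. *)
Lemma feasible_flow v : feasible_region v -> flow v.
Proof.
case=> v01 [s [s_infty s_cv]].
have sum_cv P := Un_cv_sum (index_enum 'S_k.+1) P s_cv.
split=> [e||x]; first by apply/RleP; case: (v01 e).
  apply: UL_sequence (sum_cv predT) _.
  apply: (@Un_cv_bounded_error _ _ k%:R _ s_infty) => m.
  rewrite sum_c_occ_prop count_predT /windows size_map size_iota.
  apply: le_trans (divr_nat_error _ _ _) _.
  rewrite mul1r distrC; case: (leqP k (projT1 (s m))) => [kn|/ltnW kn].
    by rewrite natrB // subKr ger0_norm.
  have -> : (projT1 (s m) - k = 0)%N by apply/eqP.
  by rewrite subr0 ger0_norm // ler_nat.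
apply/eqP; rewrite -subr_eq0; apply/eqP.
apply: UL_sequence (CV_minus _ _ _ _ (sum_cv _) (sum_cv _)) _.
apply: (@Un_cv_bounded_error _ _ 1 _ s_infty) => m.
rewrite RminusE !sum_c_occ_prop subr0 -mulrBl.
rewrite -[X in `|X| * _]subr0.
apply: le_trans (divr_nat_error _ _ _) _.
rewrite mul0r subr0; set n := projT1 _; set t := projT2 _.
case: (leqP k n) => [kn|/ltnW kn]; last first.
  by rewrite /windows (eqP kn) /= subrr normr0.
have := walk_balance x (windows_walk t kn).
move: (count _ _) (count _ _) => a b /(congr1 (fun i => i%:R : R)).
rewrite !natrD ler_norml.
by case: (_ == x); case: (_ == x); rewrite ?mulr1n ?mulr0n R1E => ?; apply/andP; split; lra.
Qed.

Lemma flow_feasible v : flow v -> feasible_region v.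
Proof.
move=> vF; split=> [p|].
  by split; apply/RleP; [exact: (flow_ge0 vF) | exact: (flow_le1 p vF)].
have [C CP] := flow_approx (@overlap_walk_ex k) vF.
(* The length of the walk is the sum of its edge counts, each off by at most C, and the realizing
   permutation is longer by k. *)
pose D : R := \sum_(p : 'S_k.+1) C + k%:R.
have [s sP] : {s : nat -> {n : nat & 'S_n} | forall m,
    `|(projT1 (s m))%:R - m%:R| <= D /\
    forall p : 'S_k.+1, `|(c_occ p (projT2 (s m)))%:R - m%:R * v p| <= C}.
  suff /choice[s sP] : forall m : nat, exists s : {n : nat & 'S_n},
      `|(projT1 s)%:R - m%:R| <= D /\
      forall p : 'S_k.+1, `|(c_occ p (projT2 s))%:R - m%:R * v p| <= C by exists s.
  move=> m; have [w wP wC] := CP m 1%g 1%g; have [s sw] := perm_realization wP.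
  exists (existT (fun n => 'S_n) _ s); split=> [|p] /=; last by rewrite c_occ_windows sw; apply: wC.
  rewrite natrD addrAC (le_trans (ler_normD _ _)) // [`|k%:R|]ger0_norm // lerD2r.
  rewrite -(count_predT w) -sum_count_mem_pred natr_sum.
  have -> : m%:R = \sum_e m%:R * v e by rewrite -mulr_sumr (flow_sum vF) mulr1.
  rewrite -sumrB.
  by apply: le_trans (ler_norm_sum _ _ _) _; apply: ler_sum => p _; exact: wC.
have s_infty M : exists N, forall m, (N <= m)%N -> (M <= projT1 (s m))%N.
  exists (M + (Num.truncn D).+1)%N => m Nm.
  have [/ler_normlP[+ _] _] := sP m; rewrite opprB => mD.
  have := truncnS_gt D; rewrite -(ler_nat R); move: Nm; rewrite -(ler_nat R) natrD.
  by lra.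
exists s; split=> // p.
apply: (@Un_cv_bounded_error _ _ (C + D) _ s_infty) => m.
have [nD /(_ p) pC] := sP m.
rewrite /c_occ_prop RdivE !INRE; apply: le_trans (divr_nat_error _ _ _) _.
(* The error splits into that of the count, at most C, and that of the size, at most D and scaled by
   v p <= 1. *)
have -> : (c_occ p (projT2 (s m)))%:R - v p * (projT1 (s m))%:R =
  (c_occ p (projT2 (s m)))%:R - m%:R * v p - v p * ((projT1 (s m))%:R - m%:R) by ring.
apply: le_trans (ler_normB _ _) _; apply: lerD => //.
rewrite normrM ger0_norm ?(flow_ge0 vF) // -[leRHS]mul1r.
by apply: ler_pM => //; [exact: (flow_ge0 vF) | exact: (flow_le1 p vF)].
Qed.

End Region.

(** * The cycle polytope *)

Lemma Rsum_big (I : Type) (r : seq I) (F : I -> R) : Rsum r F = \sum_(i <- r) F i.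
Proof. by elim: r => [|i r IH] /=; rewrite ?big_nil ?big_cons ?IH. Qed.

Lemma Rsum_filter_enum (I : finType) (P : pred I) (F : I -> R) :
  Rsum [seq i <- enum I | P i] F = \sum_(i | P i) F i.
Proof. by rewrite Rsum_big big_filter big_enum_cond. Qed.

Lemma Rsum_iota n (F : nat -> R) : Rsum (iota 0 n) F = \sum_(i < n) F i.
Proof. by rewrite Rsum_big -(big_mkord predT) /index_iota subn0. Qed.

Lemma In_mem (T : eqType) (x : T) s : List.In x s -> x \in s.
Proof. by elim: s => //= y s IH [->|/IH]; rewrite inE ?eqxx // => ->; rewrite orbT. Qed.

Lemma In_map (S T : Type) (f : S -> T) (s : seq S) y :
  List.In y (map f s) -> exists2 x, List.In x s & y = f x.
Proof.
elim: s => //= x s IH [<-|/IH[z zs ->]]; first by exists x; [left|].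
by exists z; [right|].
Qed.

Lemma In_nth (T : Type) (x0 : T) s i : (i < size s)%N -> List.In (nth x0 s i) s.
Proof. by elim: s i => [|x s IH] [|i] //=; [left | move/IH; right]. Qed.

Section Polytope.
Variable k : nat.
Implicit Types (v : vec k.+1) (w : seq 'S_k.+1).
Local Notation st := (@be k.+1).
Local Notation ar := (@en k.+1).
Local Notation flow := (@flow _ _ st ar R).
Local Notation simple_cycle := (@simple_cycle _ _ st ar).

Lemma feasible_flowP v : feasible_region v <-> flow v.
Proof. by split; [apply: feasible_flow | apply: flow_feasible]. Qed.

Lemma walk_vertices_rcons e w : path (fun e f => ov_ar e == ov_st f) e w ->
  walk_vertices (e :: w) = rcons (map st (e :: w)) (ar (last e w)).
Proof.
by elim: w e => //= f w IH e /andP[/eqP ef /IH[->]]; rewrite ef.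
Qed.

(** Removing the last entry of the vertex sequence leaves the starts, removing the first leaves the
    arrivals; distinctness of the starts carries over to the arrivals by [simple_cycle_ar_inj]. *)
Lemma is_simple_cycleE w : is_simple_cycle w = simple_cycle w.
Proof.
case: w => // e w; apply/idP/idP.
  rewrite /is_simple_cycle /is_cycle /is_path /is_walk.
  move=> /andP[/andP[_ /andP[we /eqP cl]] /andP[/andP[_ st_uniq] _]].
  apply/and3P; split=> //.
    by rewrite /= rcons_path; apply/andP; split; last exact/eqP/esym.
  move: st_uniq.
  by rewrite walk_vertices_rcons // -cats1 -(size_map st (e :: w)) take_size_cat.
move=> wC; have /and3P[_ + st_uniq] := wC; rewrite /= rcons_path => /andP[we cl].
have w_uniq := simple_cycle_uniq wC.
rewrite /is_simple_cycle /is_cycle /is_path /is_walk [sorted _ _]we.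
rewrite [ov_st e == _]eq_sym [_ == ov_st e]cl w_uniq.
rewrite walk_vertices_rcons // -cats1 -(size_map st (e :: w)) take_size_cat // st_uniq.
rewrite cats1 -walk_vertices_rcons //.
rewrite -[drop 1 _]/(map ar (e :: w)) map_inj_in_uniq //; apply: simple_cycle_ar_inj wC.
Qed.

Lemma cycle_vecE w p : cycle_vec w p = cycle_weight R w p.
Proof. by rewrite /cycle_vec RdivE !INRE. Qed.

Lemma cycle_vec_flow v w : simple_cycle w -> (forall p, v p = cycle_vec w p) -> flow v.
Proof.
move=> wC vw; have -> : v = cycle_weight R w; last exact: cycle_weight_flow.
by apply/funext => p; rewrite vw cycle_vecE.
Qed.

(** The total weight is left free: this suits the induction, and shows that the weights in a cycle
    decomposition of a flow sum to 1. *)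
Lemma conv_flow (l : seq (R * vec k.+1)) :
  (forall c, List.In c l -> 0 <= c.1 /\ flow c.2) ->
  let v p := \sum_(c <- l) c.1 * c.2 p in
  [/\ forall p, 0 <= v p, \sum_p v p = \sum_(c <- l) c.1 & balanced st ar v].
Proof.
move=> lP v; rewrite {}/v; elim: l lP => [_|c l IH lP].
  split=> [p||x]; first by rewrite big_nil.
    by rewrite big_nil big1 // => p _; rewrite big_nil.
  by rewrite !big1 // => p _; rewrite big_nil.
have [|v_ge0 v_sum vb] := IH; first by move=> d dl; apply: lP; right.
have [c_ge0 [c2_ge0 c2_sum c2b]] := lP c (or_introl erefl).
split=> [p||x].
- by rewrite big_cons addr_ge0 ?mulr_ge0.
- under eq_bigr => p _ do rewrite big_cons.
  by rewrite big_split /= -mulr_sumr c2_sum mulr1 v_sum big_cons.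
under eq_bigr => p _ do rewrite big_cons.
under [RHS]eq_bigr => p _ do rewrite big_cons.
by rewrite !big_split /= -!mulr_sumr c2b vb.
Qed.

Lemma cycle_polytope_flowP v : cycle_polytope v <-> flow v.
Proof.
split=> [[l [lP [l_sum vE]]]|vF].
  have lF c : List.In c l -> 0 <= c.1 /\ flow c.2.
    case/lP => /RleP c_ge0 [w [wC cw]]; split=> //.
    by apply: cycle_vec_flow cw; rewrite -is_simple_cycleE.
  have [v_ge0 v_sum vb] := conv_flow lF.
  have -> : v = fun p => \sum_(c <- l) c.1 * c.2 p.
    by apply/funext => p; rewrite vE Rsum_big.
  by split=> //; rewrite v_sum -Rsum_big l_sum.
have [v_ge0 v_sum vb] := vF; have [l lP vE] := cycle_decomposition v_ge0 vb.
pose g (c : R * seq 'S_k.+1) : R * vec k.+1 := (c.1, cycle_weight R c.2).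
have gP c : List.In c (map g l) -> 0 <= c.1 /\ exists2 w, simple_cycle w & c.2 = cycle_weight R w.
  move=> cl; have [d dl ->] := In_map cl.
  by have [d_ge0 dC] := lP d (In_mem dl); split=> //; exists d.2.
have gF c : List.In c (map g l) -> 0 <= c.1 /\ flow c.2.
  by case/gP => c_ge0 [w wC ->]; split=> //; apply: cycle_weight_flow.
have vgE p : v p = \sum_(c <- map g l) c.1 * c.2 p by rewrite vE big_map.
exists (map g l); split=> [c /gP[c_ge0 [w wC cw]]|]; last split.
- split; first exact/RleP.
  by exists w; rewrite is_simple_cycleE; split=> // p; rewrite cw cycle_vecE.
- have [_ l_sum _] := conv_flow gF; rewrite Rsum_big -l_sum.
  by rewrite -[RHS]v_sum; apply: eq_bigr => p _; rewrite vgE.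
- by move=> p; rewrite vgE Rsum_big.
Qed.

Lemma vertex_cycleP v : is_vertex (@feasible_region k.+1) v <->
  exists w, is_simple_cycle w /\ forall p, v p = cycle_vec w p.
Proof.
split=> [[/feasible_flowP vF v_ext]|[w [wC vw]]].
  have [y z t yF zF /andP[t_gt0 t_lt1] vE|w wC vw] := extreme_cycle_weight vF.
    apply: (v_ext y z t); [exact/feasible_flowP|exact/feasible_flowP| |exact: vE].
    by split; apply/RltP.
  by exists w; rewrite is_simple_cycleE; split=> // p; rewrite vw cycle_vecE.
rewrite is_simple_cycleE in wC.
split=> [|y z t /feasible_flowP yF /feasible_flowP zF [/RltP t_gt0 /RltP t_lt1] vE].
  exact/feasible_flowP/(cycle_vec_flow wC vw).
apply: (cycle_weight_extreme wC yF zF (t := t)); first by rewrite t_gt0.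
by move=> p; rewrite -cycle_vecE -vw vE.
Qed.

Lemma flow_equationsP v : flow v <->
  (forall p, Rle R0 (v p) /\ Rle (v p) R1) /\
  Rsum (enum 'S_k.+1) v = R1 /\
  (forall x, Rsum [seq p <- enum 'S_k.+1 | be p == x] v =
             Rsum [seq p <- enum 'S_k.+1 | en p == x] v).
Proof.
have sumE : Rsum (enum 'S_k.+1) v = \sum_p v p by rewrite Rsum_big big_enum.
split=> [vF|[v01 [v_sum vb]]].
  split=> [p|]; first by split; apply/RleP; [apply: (flow_ge0 vF) | apply: (flow_le1 p vF)].
  split=> [|x]; first by rewrite sumE (flow_sum vF).
  by rewrite !Rsum_filter_enum (flow_balanced vF).
split=> [p||x]; first by apply/RleP; case: (v01 p).
  by rewrite -sumE.
by have := vb x; rewrite !Rsum_filter_enum.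
Qed.

(** Every window of an increasing word is increasing. This provides the loop used in the rank
    computation. *)
Lemma be1_en1 : st 1%g = ar 1%g.
Proof.
have lt_w (c : 'I_k) : (c < k.+1)%N by apply: leqW.
apply: std_unique => a b; rewrite /en std_ltn.
  rewrite (pval_ord _ (Ordinal (lt_w a))) (pval_ord _ (Ordinal (lt_w b))).
  by rewrite (pval_ord _ (lift ord0 a)) (pval_ord _ (lift ord0 b)) !perm1.
move=> c d; rewrite (pval_ord _ (lift ord0 c)) (pval_ord _ (lift ord0 d)).
by move=> /val_inj/perm_inj/lift_inj.
Qed.

Lemma feasible_dim : has_dim (@feasible_region k.+1) (k.+1`! - k`!).
Proof.
rewrite -!card_Sn; set d := (_ - _)%N; split.
  have [x [xF x_indep]] := flow_aff_indep (@overlap_walk_ex k) be1_en1 (@be_en_balanced R k).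
  have nthE i p : (i < d.+1)%N -> nth (fun=> R0) (mkseq x d.+1) i p = x i p.
    by move=> lti; rewrite nth_mkseq.
  exists (mkseq x d.+1); rewrite size_mkseq; split=> //; split.
    by move=> y yl; have [i _ ->] := In_map yl; apply/feasible_flowP.
  move=> lam; rewrite size_mkseq Rsum_iota => lam0 lamx; apply: x_indep => // p.
  apply: etrans (lamx p); rewrite Rsum_iota; apply: eq_bigr => i _.
  by rewrite nthE.
move=> l l_size lF l_indep; pose x := nth (fun=> R0 : R) l.
have [i lti|lam [lam0 lamx [i lti]]] := flow_aff_dep (@overlap_walk_ex k) be1_en1 (x := x).
  by apply/feasible_flowP/lF/In_nth; rewrite l_size.
move/eqP; apply; apply: l_indep; rewrite ?l_size //; first by rewrite Rsum_iota.
by move=> p; rewrite Rsum_iota; apply: lamx.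
Qed.

End Polytope.

Theorem mainTheorem13 (k : nat) (hk : (2 <= k)%N) :
  (forall v : vec k, feasible_region v <-> cycle_polytope v) /\
  (forall v : vec k, is_vertex (@feasible_region k) v <->
     exists w : seq 'S_k, is_simple_cycle w /\ forall p, v p = cycle_vec w p) /\
  has_dim (@feasible_region k) (k`! - (k.-1)`!) /\
  (forall v : vec k, feasible_region v <->
     ((forall p : 'S_k, Rle R0 (v p) /\ Rle (v p) R1) /\
      Rsum (enum 'S_k) v = R1 /\
      (forall rho : 'S_k.-1,
         Rsum [seq p <- enum 'S_k | be p == rho] v =
         Rsum [seq p <- enum 'S_k | en p == rho] v))).
Proof.
(* With k replaced by [k.+1], the vertex type ['S_k.+1.-1] reduces to ['S_k]. *)
case: k hk => // k _; split=> [v|].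
  exact: iff_trans (feasible_flowP v) (iff_sym (cycle_polytope_flowP v)).
split; first exact: vertex_cycleP.
split; first exact: feasible_dim.
by move=> v; apply: iff_trans (feasible_flowP v) (flow_equationsP v).
Qed.
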